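(* Let $G$ be a finite $k$-regular partial cube with girth $g(G)=6$. Then the following are equivalent: (a) every convex cycle of $G$ is a $6$-cycle; (b) every $3$-path of $G$ is contained in a $6$-cycle of $G$; (c) $G\cong\tilde{O}_k$.
   Context: A partial cube is a connected graph isomorphic to an isometric subgraph of a hypercube. A subgraph $H$ is convex if for all $u,v\in V(H)$ every shortest $u,v$-path of $G$ lies in $H$; a convex cycle is a cycle that is a convex subgraph. The girth $g(G)$ is the length of a shortest cycle. An $l$-path ($l$-cycle) is a path (cycle) with $l$ edges; a path is contained in a cycle if it is a subpath of it. For $k\geqslant 1$, the Doubled Odd graph $\tilde{O}_k$ is the bipartite graph whose two parts are the $(k-1)$-element subsets and the $k$-element subsets of $\{1,\dots,2k-1\}$, with a $(k-1)$-subset $u$ adjacent to a $k$-subset $v$ iff $u\subset v$. *)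

(* Defs.v *)
(* Finite simple graphs as symmetric irreflexive relations
   on a finType. *)
From mathcomp Require Import all_boot.
Set Implicit Arguments. Unset Strict Implicit. Unset Printing Implicit Defensive.

Section Graphs.
Variables (T : finType) (e : rel T).

Definition walk_len (u v : T) (n : nat) : Prop :=
  exists p : seq T, [&& path e u p, last u p == v & size p == n].

Definition is_dist (u v : T) (d : nat) : Prop :=
  walk_len u v d /\ forall m, walk_len u v m -> d <= m.

Definition shortest_path (u v : T) (p : seq T) : Prop :=
  [&& path e u p & last u p == v] /\ is_dist u v (size p).

Definition hamming n (a b : {ffun 'I_n -> bool}) : nat :=
  #|[set i | a i != b i]|.

(* partial cube: connected graph isometrically embeddable into a hypercube,
   i.e. isomorphic to an isometric subgraph of some Q_n
   (isometry forces connectedness, injectivity and edge preservation). *)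
Definition partial_cube : Prop :=
  exists n (f : T -> {ffun 'I_n -> bool}),
    forall u v, is_dist u v (hamming (f u) (f v)).

Definition regular (k : nat) : Prop := forall v, #|[set w | e v w]| = k.

Definition is_cycle (c : seq T) : Prop := [&& uniq c, 3 <= size c & cycle e c].

Definition girth_is (g : nat) : Prop :=
  (exists c, is_cycle c /\ size c = g) /\ forall c, is_cycle c -> g <= size c.

Definition cycle_edge (c : seq T) (x y : T) : bool :=
  [&& x \in c, y \in c & (next c x == y) || (next c y == x)].

Definition convex_cycle (c : seq T) : Prop :=
  is_cycle c /\
  forall u v p, u \in c -> v \in c -> shortest_path u v p ->
    all (fun x => x \in c) (u :: p) /\ path (cycle_edge c) u p.

Definition is_lpath (l : nat) (p : seq T) : Prop :=
  [/\ uniq p, size p = l.+1 & exists x q, p = x :: q /\ path e x q].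

Definition path_in_cycle (p c : seq T) : Prop :=
  exists i, take (size p) (rot i c) = p \/ take (size p) (rot i (rev c)) = p.

Definition convex_cycles_are_6 : Prop :=
  forall c, convex_cycle c -> size c = 6.

Definition three_paths_in_6cycles : Prop :=
  forall p, is_lpath 3 p -> exists c, is_cycle c /\ size c = 6 /\ path_in_cycle p c.

End Graphs.

Definition dodd_vert (k : nat) := 
  {A : {set 'I_(2 * k).-1} | (#|A| == k.-1) || (#|A| == k)}.

Definition dodd_adj (k : nat) : rel (dodd_vert k) := fun A B =>
  [&& #|val A| == k.-1, #|val B| == k & val A \subset val B] ||
  [&& #|val B| == k.-1, #|val A| == k & val B \subset val A].

Definition graph_iso (T T' : finType) (e : rel T) (e' : rel T') : Prop :=
  exists f : T -> T', bijective f /\ forall x y, e x y = e' (f x) (f y).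

(* Main.v *)
(** The vertices are identified with sets of labels (their coordinates in the
    hypercube), so that an edge flips one label and the distance is the size of
    the symmetric difference. The zone of a label [b] is the set of edges that
    flip [b].

    If two edges of a zone have no third one in the interval between them, this
    interval together with its translate by [b] is a convex cycle, hence a
    hexagon by (a). So inside intervals the edges of a zone are linked by
    hexagons. It follows that two edges leaving [u] towards [v] lie in a hexagon
    inside the interval from [u] to [v], and that a zone closes up along
    intervals. Therefore, if a halfspace of a label [b] contains a vertex [y] at
    distance two from an endpoint [u] of the zone of [b] but not on that zone,
    the last label on a path from [u] to [y] cuts off a strictly smaller
    halfspace. In a halfspace of minimal size there is no such [y], and
    regularity then forces all 3-paths around [u] into hexagons.

    This local condition at [u] (all neighbours of [u] have the same further
    labels [Y]) determines the neighbourhoods of all vertices: up to translation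
    they are the subsets of sizes [k-1] and [k] of [X :|: Y], where [X] is the
    set of labels at [u]. *)
Require Import Defs.
From mathcomp Require Import all_boot zify.
Set Implicit Arguments. Unset Strict Implicit. Unset Printing Implicit Defensive.

(** * Flips and symmetric differences of label sets *)

Definition flip (L : finType) (A : {set L}) i := [set x | (x \in A) (+) (x == i)].
Definition sep (L : finType) (A B : {set L}) := [set x | (x \in A) (+) (x \in B)].

Local Notation "A ^^ i" := (flip A i) (at level 29, left associativity).

Section Flip.
Variable L : finType.
Implicit Types (A B C D : {set L}) (i j x : L).

Lemma in_flip A i x : (x \in A ^^ i) = (x \in A) (+) (x == i).
Proof. by rewrite inE. Qed.

Lemma in_sep A B x : (x \in sep A B) = (x \in A) (+) (x \in B).
Proof. by rewrite inE. Qed.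

Lemma flipC A i j : A ^^ i ^^ j = A ^^ j ^^ i.
Proof. by apply/setP=> x; rewrite !inE addbAC. Qed.

Lemma flipK A i : A ^^ i ^^ i = A.
Proof. by apply/setP=> x; rewrite !inE -addbA addbb addbF. Qed.

Lemma flip_inj A : injective [eta flip A].
Proof.
by move=> i j /setP/(_ i); rewrite !inE eqxx => /addbI/esym/eqP.
Qed.

Lemma flip_neq A i : A ^^ i != A.
Proof. by apply/eqP=> /setP/(_ i); rewrite !inE eqxx addbT; case: (i \in A). Qed.

Lemma sepC A B : sep A B = sep B A.
Proof. by apply/setP=> x; rewrite !inE addbC. Qed.

Lemma sepAA A : sep A A = set0.
Proof. by apply/setP=> x; rewrite !inE addbb. Qed.

Lemma sep_eq0 A B : (sep A B == set0) = (A == B).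
Proof.
apply/eqP/eqP=> [/setP AB | ->]; last exact: sepAA.
by apply/setP=> x; move: (AB x); rewrite !inE; do 2!case: (_ \in _).
Qed.

Lemma sepI A B C : sep A B = sep A C -> B = C.
Proof. by move/setP=> e; apply/setP=> x; move: (e x); rewrite !inE => /addbI. Qed.

Lemma in_sep_flip A B i x : (x \in sep (A ^^ i) B) = (x \in sep A B) (+) (x == i).
Proof. by rewrite !inE addbAC. Qed.

Lemma in_sep_flipr A B i x : (x \in sep A (B ^^ i)) = (x \in sep A B) (+) (x == i).
Proof. by rewrite !inE addbA. Qed.

Lemma in_sep_mid B A C x : (x \in sep A C) = (x \in sep A B) (+) (x \in sep B C).
Proof. by rewrite !inE; do 3!case: (_ \in _). Qed.

Lemma sep_flip A i : sep A (A ^^ i) = [set i].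
Proof. by apply/setP=> x; rewrite !inE addbA addbb. Qed.

Lemma sep1 A B i : sep A B = [set i] -> B = A ^^ i.
Proof. by rewrite -(sep_flip A) => /sepI. Qed.

Lemma sep_flipD A B i : i \in sep A B -> sep (A ^^ i) B = sep A B :\ i.
Proof.
move=> iAB; apply/setP=> x; rewrite in_sep_flip in_setD1.
by case: eqVneq => [->|]; rewrite ?iAB ?addbF ?addbT.
Qed.

Lemma sep_fliprD A B i : i \in sep A B -> sep A (B ^^ i) = sep A B :\ i.
Proof. by rewrite !(sepC A); apply: sep_flipD. Qed.

Lemma sep_fliprU A B i : i \notin sep A B -> sep A (B ^^ i) = i |: sep A B.
Proof.
move=> iAB; apply/setP=> x; rewrite in_sep_flipr in_setU1.
by case: eqVneq => [->|]; rewrite ?(negPf iAB) ?addbF ?addbT.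
Qed.

Lemma card_sep_flip A B i : i \in sep A B -> #|sep A B| = #|sep (A ^^ i) B|.+1.
Proof. by move=> iAB; rewrite (cardsD1 i) iAB sep_flipD. Qed.

Lemma sep_sub_mid A B C D : sep A C \subset D -> sep A B \subset D -> sep C B \subset D.
Proof.
move=> /subsetP AC /subsetP AB; apply/subsetP=> x xCB.
case: (boolP (x \in sep A C)) => [/AC // | xAC]; apply: AB.
by move: xCB xAC; rewrite !inE; do 3!case: (_ \in _).
Qed.

End Flip.

(** * Isometric set families *)

Section Family.
Variables (L : finType) (F : {set {set L}}).
Implicit Types (u v w : {set L}) (b c f g h i j z : L).

(** Iterating [isoF] yields geodesics inside [F], so [F] is an isometric subgraph of the hypercube;
    [nosq] excludes 4-cycles. *)
Hypothesis isoF : forall u v, u \in F -> v \in F -> u != v ->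
  exists2 i, i \in sep u v & u ^^ i \in F.
Hypothesis nosq : forall u i j, i != j -> u \in F -> u ^^ i \in F ->
  u ^^ j \in F -> u ^^ i ^^ j \notin F.

Lemma flip_two_step u i j : i != j -> u \in F -> u ^^ i ^^ j \in F ->
  (u ^^ i \in F) || (u ^^ j \in F).
Proof.
move=> ij uF ijF.
have [|c] := isoF uF ijF.
  by apply/eqP=> /setP/(_ i); rewrite !inE eqxx (negPf ij); case: (i \in u).
rewrite !in_sep_flipr sepAA inE /=.
case: (eqVneq c i) => [-> _ -> //|_]; case: (eqVneq c j) => [-> _ ->|//].
by rewrite orbT.
Qed.

(** The sets [u ^^ i ^^ c] and [u ^^ j ^^ c] are at distance two, and their other possible midpoint
    [u ^^ c] would complete a square at [u]. *)
Lemma hexagon u i j c : i != j -> c != i -> c != j -> u \in F ->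
  u ^^ i \in F -> u ^^ j \in F -> u ^^ i ^^ c \in F -> u ^^ j ^^ c \in F ->
  u ^^ i ^^ j ^^ c \in F.
Proof.
move=> ij ci cj uF iF jF icF jcF.
have: (u ^^ i ^^ c ^^ i \in F) || (u ^^ i ^^ c ^^ j \in F).
  by apply: flip_two_step; rewrite // (flipC u i c) flipK (flipC u c j).
rewrite (flipC u i c) flipK (flipC u c i) (flipC _ c j) => /orP[cF|//].
by have := nosq ci uF cF iF; rewrite flipC icF.
Qed.

(** The sets [u ^^ b] and [u ^^ i ^^ c ^^ b] are at distance two, and the midpoint [u ^^ b ^^ i]
    would complete a square. *)
Lemma zone_label u b i c : b != i -> c != i -> u \in F -> u ^^ b \in F ->
  u ^^ i \in F -> u ^^ i ^^ c ^^ b \in F -> u ^^ b ^^ c \in F.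
Proof.
move=> bi ci uF bF iF; rewrite flipC (flipC u i b) => icbF.
have /orP[biF|//] : (u ^^ b ^^ i \in F) || (u ^^ b ^^ c \in F).
  by apply: flip_two_step; rewrite // eq_sym.
by have := nosq bi uF bF iF; rewrite biF.
Qed.

(** Across the zone the given data yield [u ^^ b ^^ c], which does not depend on [i]; the hexagon on
    [b] and [j] then closes up. *)
Lemma zone_transfer u b i j c : b != i -> b != j -> c != b -> c != i -> c != j ->
  u \in F -> u ^^ b \in F -> u ^^ i \in F -> u ^^ i ^^ c ^^ b \in F ->
  u ^^ j \in F -> u ^^ j ^^ c \in F -> u ^^ j ^^ c ^^ b \in F.
Proof.
move=> bi bj cb ci cj uF bF iF icbF jF jcF.
have bcF := zone_label bi ci uF bF iF icbF.
by rewrite flipC (flipC u); apply: hexagon.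
Qed.

(** A geodesic from [u] to [v] flips [b] once, and [w] is its vertex just before that flip. *)
Lemma crossing_edge b u v : u \in F -> v \in F -> b \in sep u v ->
  exists w, [/\ w \in F, w ^^ b \in F & sep u w \subset sep u v :\ b].
Proof.
have [n] := ubnP #|sep u v|; elim: n u => // n IHn u le uF vF buv.
have [|i iuv uiF] := isoF uF vF; first by apply: contraTneq buv => ->; rewrite sepAA inE.
have [ib|ib] := eqVneq i b; first by exists u; rewrite sepAA sub0set -ib.
have bi : b \in sep (u ^^ i) v by rewrite in_sep_flip buv eq_sym (negPf ib).
have [|w [wF wbF sub]] := IHn _ _ uiF vF bi; first by rewrite -ltnS -(card_sep_flip iuv).
exists w; split=> //; apply: (@sep_sub_mid _ (u ^^ i)).
  by rewrite sepC sep_flip sub1set in_setD1 ib.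
by rewrite (subset_trans sub) // sep_flipD // setSD // subD1set.
Qed.

Lemma interval_level u v (i : nat) : u \in F -> v \in F -> i <= #|sep u v| ->
  exists w, [/\ w \in F, sep u w \subset sep u v & #|sep u w| = i].
Proof.
have [n] := ubnP #|sep u v|; elim: n v => // n IHn v le uF vF.
rewrite leq_eqVlt => /predU1P[->|lt]; first by exists v.
have [|j jvu vjF] := isoF vF uF.
  by apply: contraTneq lt => ->; rewrite sepAA cards0.
have e : #|sep u v| = #|sep u (v ^^ j)|.+1.
  by rewrite !(sepC u); apply: card_sep_flip.
have [||w [wF sub wi]] := IHn (v ^^ j) _ uF vjF; try by rewrite -ltnS -e.
by exists w; split; rewrite // (subset_trans sub) // sep_fliprD ?subD1set // sepC.
Qed.

(** * Consecutive edges of a zone *)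

(** Only the side of [u] and [v] is inspected; [consecutive_opp] moves the condition across the
    zone, with the ends swapped as for a cycle running back. *)
Definition consecutive b u v := b \notin sep u v /\
  forall t, t \in F -> t ^^ b \in F -> sep u t \subset sep u v -> t = u \/ t = v.

Lemma sep_flip_flip b u v : sep (u ^^ b) (v ^^ b) = sep u v.
Proof. by apply/setP=> x; rewrite in_sep_flip in_sep_flipr -addbA addbb addbF. Qed.

Lemma consecutive_opp b u v : consecutive b u v -> consecutive b (v ^^ b) (u ^^ b).
Proof.
move=> [buv consec]; split=> [|t tF tbF]; rewrite sep_flip_flip (sepC v u) //.
rewrite -(sep_flip_flip b (v ^^ b)) flipK => sub.
have [||tu|tv] := consec (t ^^ b) tbF; first by rewrite flipK.
- by apply: (@sep_sub_mid _ v); rewrite // sepC.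
- by right; rewrite -tu flipK.
- by left; rewrite -tv flipK.
Qed.

Section ConsecutiveEdges.
Variables (b : L) (u v : {set L}).
Hypotheses (ubF : u ^^ b \in F) (vbF : v ^^ b \in F).
Hypothesis consec_uv : consecutive b u v.

(* A geodesic from [w] to [w'] crosses the zone of [b] inside the interval from
   [u] to [v], hence at one of its two ends. *)
Lemma consecutive_sides w w' : w \in F -> w' \in F ->
  sep u w \subset sep u v -> sep (u ^^ b) w' \subset sep u v ->
  #|sep u w| + #|sep (u ^^ b) w'| = #|sep u v| ->
  sep u w = sep u v :\: sep (u ^^ b) w'.
Proof.
have [buv consec] := consec_uv; move=> wF w'F sub sub' cE.
have bu : b \notin sep u w by apply: contra buv; apply: (subsetP sub).
have bu' : b \notin sep (u ^^ b) w' by apply: contra buv; apply: (subsetP sub').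
have ww' x : x != b -> (x \in sep w w') = (x \in sep u w) (+) (x \in sep (u ^^ b) w').
  by move=> /negPf xb; rewrite (in_sep_mid u) in_sep_flip xb addbF sepC.
have [|t [tF tbF tsub]] := crossing_edge wF w'F (b := b).
  rewrite (in_sep_mid u) sepC (negPf bu) /=.
  by move: bu'; rewrite in_sep_flip eqxx addbT negbK.
have tin x : x \in sep w t -> (x != b) && ((x \in sep u w) (+) (x \in sep (u ^^ b) w')).
  by move=> /(subsetP tsub); rewrite in_setD1 => /andP[xb]; rewrite ww' ?xb.
have utsub : sep u t \subset sep u v.
  apply/subsetP=> x; rewrite (in_sep_mid w).
  case: (boolP (x \in sep u w)) => [/(subsetP sub)-> //|xu] /= /tin.
  by rewrite (negPf xu) => /andP[_ /(subsetP sub')].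
(* Each end gives one of the two inclusions; the cardinalities turn it into equality. *)
have [tu|tv] := consec t tF tbF utsub; last first.
  apply/eqP; rewrite eq_sym eqEcard; apply/andP; split.
    apply/subsetP=> x; rewrite in_setD => /andP[xn xuv]; apply: contraT => xu.
    have: x \in sep w t by rewrite tv (in_sep_mid u) sepC (negPf xu).
    by move/tin; rewrite (negPf xu) (negPf xn) andbF.
  by rewrite cardsD (setIidPr sub') -cE addnK.
apply/eqP; rewrite eqEcard; apply/andP; split.
  apply/subsetP=> x xu; rewrite in_setD (subsetP sub) // andbT.
  have: x \in sep w t by rewrite tu sepC.
  by move/tin=> /andP[_]; rewrite xu.
by rewrite cardsD (setIidPr sub') -cE addnK.
Qed.

(** One vertex [w'] of the opposite interval, at the complementary level, determines [sep u w1] and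
    [sep u w2] alike. *)
Lemma consecutive_level w1 w2 : w1 \in F -> w2 \in F ->
  sep u w1 \subset sep u v -> sep u w2 \subset sep u v ->
  #|sep u w1| = #|sep u w2| -> w1 = w2.
Proof.
move=> w1F w2F sub1 sub2 e12.
have e := sep_flip_flip b u v.
have [|w' [w'F]] := interval_level (i := #|sep u v| - #|sep u w1|) ubF vbF.
  by rewrite e leq_subr.
rewrite e => sub' cw'.
have cE : #|sep u w1| + #|sep (u ^^ b) w'| = #|sep u v|.
  by rewrite cw' subnKC // subset_leq_card.
apply: (@sepI _ u); rewrite (consecutive_sides w1F w'F sub1 sub' cE).
by rewrite -(consecutive_sides w2F w'F sub2 sub') // -e12.
Qed.

End ConsecutiveEdges.

(** * Hexagons inside intervals *)

(** This is the form in which condition (a) enters; [convex_6_consecutive] supplies it. *)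
Hypothesis zone2 : forall b u v, u \in F -> u ^^ b \in F -> v \in F ->
  v ^^ b \in F -> u != v -> consecutive b u v -> #|sep u v| = 2.

(** The edge of the zone nearest to [u] in the interval is consecutive to the one at [u], hence at
    distance two by [zone2]. *)
Lemma zone_step b u v : u \in F -> u ^^ b \in F -> v \in F -> v ^^ b \in F ->
  u != v -> b \notin sep u v ->
  exists g c, [/\ g \in sep u v, c \in sep u v, c != g &
    [/\ u ^^ g \in F, u ^^ g ^^ c \in F, u ^^ g ^^ c ^^ b \in F & u ^^ b ^^ c \in F]].
Proof.
move=> uF ubF vF vbF uv buv.
pose P s := [&& s \in F, s ^^ b \in F, s != u & sep u s \subset sep u v].
have Pv : P v by rewrite /P vF vbF eq_sym uv subxx.
case: (arg_minnP (fun s => #|sep u s|) Pv) => s /and4P[sF sbF su sub] smin.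
have bus : b \notin sep u s by apply: contra buv; apply: (subsetP sub).
have /eqP/cards2P[g [c [gc eus]]] : #|sep u s| = 2.
  apply: (zone2 uF ubF sF sbF); first by rewrite eq_sym.
  split=> // t tF tbF ts; case: (eqVneq t u) => [|tu]; [by left | right].
  apply: (@sepI _ u); apply/eqP; rewrite eqEcard ts; apply: smin.
  by rewrite /P tF tbF tu (subset_trans ts).
have {eus} es: s = u ^^ g ^^ c.
  apply: (@sepI _ u); rewrite eus; apply/setP=> x.
  rewrite !in_sep_flipr sepAA !inE.
  by case: (eqVneq x g) => [->|_]; rewrite ?(negPf gc).
have gs : g \in sep u s by rewrite es !in_sep_flipr sepAA inE eqxx (negPf gc).
have cs : c \in sep u s.
  by rewrite es !in_sep_flipr sepAA inE eqxx eq_sym (negPf gc).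
have bg : b != g by apply: contraNneq bus => ->.
have bc : b != c by apply: contraNneq bus => ->.
have guv := subsetP sub _ gs; have cuv := subsetP sub _ cs.
rewrite es in sF sbF.
(* The two labels come unordered; the one whose flip stays in [F] is taken first. *)
have /orP[gF|cF] := flip_two_step gc uF sF.
  exists g, c; split=> //; first by rewrite eq_sym.
  by split=> //; apply: (@zone_label _ _ g) => //; rewrite eq_sym.
exists c, g; split=> //; rewrite -(flipC u) in sF sbF *.
by split=> //; apply: (@zone_label _ _ c) => //; rewrite -(flipC u).
Qed.

(* The next two properties are proved by a simultaneous induction on [n]:
   a hexagon at [u] is obtained from one at a later vertex [x] of the interval
   because the zones of [b] and [z] both contain the interval from [u] to [x]. *)
Definition diverging_edges n := forall u v b z, u \in F -> v \in F ->
  #|sep u v| <= n -> b \in sep u v -> z \in sep u v -> b != z ->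
  u ^^ b \in F -> u ^^ z \in F ->
  exists c, [/\ c \in sep u v, c != b, c != z, u ^^ b ^^ c \in F & u ^^ z ^^ c \in F].

Definition zone_intervals n := forall u v b f h, u \in F -> u ^^ b \in F ->
  v \in F -> v ^^ b \in F -> b \notin sep u v -> #|sep u v| <= n ->
  f \in sep u v -> h \in sep u v -> h != f -> u ^^ f \in F ->
  u ^^ f ^^ h \in F -> u ^^ f ^^ h ^^ b \in F.

(** A step from [v] towards [u ^^ z], rather than [u], cannot flip [z]. If it did not flip [b]
    either, it would reach another vertex separated from [u] by both labels. *)
Lemma minimal_last_step u v b z : b != z -> u \in F -> v \in F -> u ^^ z \in F ->
  b \in sep u v -> z \in sep u v ->
  (forall x, x \in F -> sep u x \subset sep u v -> b \in sep u x -> z \in sep u x ->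
     x = v) ->
  v ^^ b \in F.
Proof.
move=> bz uF vF uzF buv zuv min.
have [|i] := isoF vF uzF.
  by apply: contraTneq buv => ->; rewrite in_sep_flipr sepAA inE.
rewrite sepC in_sep_flip => + viF.
case: (eqVneq i b) viF => [->//|ib viF].
case: (eqVneq i z) => [->|iz]; first by rewrite zuv.
rewrite addbF => iv; case/eqP: (flip_neq v i).
by apply: min; rewrite // sep_fliprD ?subD1set // in_setD1 eq_sym ?ib ?iz.
Qed.

(** After shrinking [v], no other vertex of the interval is separated from [u] by both [b] and [z].
    A hexagon on these labels is found at a vertex [x], and carried back to [u] because [u] and [x]
    lie on both zones. *)
Lemma diverging_edgesS n :
  diverging_edges n -> zone_intervals n -> diverging_edges n.+1.
Proof.
move=> IHd IHz u v b z uF vF len buv zuv bz ubF uzF.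
have [/exists_inP[x xF /and4P[xv sub bx zx]] | /exists_inPn min] :=
  boolP [exists x in F, [&& x != v, sep u x \subset sep u v,
                            b \in sep u x & z \in sep u x]].
  have lt : #|sep u x| < #|sep u v|.
    apply: proper_card; rewrite properEneq sub andbT.
    by apply: contra xv => /eqP/sepI->.
  have [|c [cx cb cz bcF zcF]] := IHd u x b z uF xF _ bx zx bz ubF uzF.
    by rewrite -ltnS (leq_trans lt len).
  by exists c; split=> //; apply: (subsetP sub).
have {}min x : x \in F -> sep u x \subset sep u v -> b \in sep u x ->
    z \in sep u x -> x = v.
  by move=> xF sub bx zx; apply/eqP; move: (min x xF); rewrite sub bx zx !andbT negbK.
have zb : z != b by rewrite eq_sym.
have vbF : v ^^ b \in F by apply: (minimal_last_step bz uF).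
(* The vertex [x] is taken as far from [u] as possible on the zone of [b] without crossing [z], so
   that the next hexagon of this zone must flip [z]. *)
pose P x := [&& x \in F, x ^^ b \in F, z \notin sep u x & sep u x \subset sep u (v ^^ b)].
have Pu : P u by rewrite /P uF ubF sepAA inE sub0set.
case: (arg_maxnP (fun x => #|sep u x|) Pu) => x /and4P[xF xbF zx sub] xmax.
have subv : sep u (v ^^ b) = sep u v :\ b by rewrite sep_fliprD.
have bx : b \notin sep u x.
  by apply/negP=> /(subsetP sub); rewrite subv !inE eqxx.
have subx : sep u x \subset sep u v by rewrite (subset_trans sub) // subv subD1set.
have insep i : i \in sep x (v ^^ b) -> [/\ i \notin sep u x, i \in sep u v & i != b].
  move=> ix; have: i \in sep u (v ^^ b) -> i \in sep u v /\ i != b.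
    by rewrite subv in_setD1 => /andP[].
  move: (in_sep_mid x u (v ^^ b) i) (subsetP sub i); rewrite ix addbT.
  by case: (i \in sep u x) => /= [-> /(_ isT)|-> _ /(_ isT)[]].
have zxv : z \in sep x (v ^^ b).
  move: (in_sep_mid x u (v ^^ b) z).
  by rewrite (negPf zx) in_sep_flipr zuv (negPf zb) /= => <-.
have vbbF : v ^^ b ^^ b \in F by rewrite flipK.
have [||g [c [gx cx cg [xgF xgcF xgcbF xbcF]]]] := zone_step xF xbF vbF vbbF.
- by apply: contraTneq zxv => <-; rewrite sepAA inE.
- by apply/negP=> /insep[_ _]; rewrite eqxx.
have [gx' guv gb] := insep g gx; have [cx' cuv cb] := insep c cx.
have zgc : (z == g) || (z == c).
  apply/negPn/negP; rewrite negb_or => /andP[zg zc].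
  have cgx' : c \notin sep u (x ^^ g) by rewrite in_sep_flipr (negPf cx') (negPf cg).
  have /xmax : P (x ^^ g ^^ c).
    rewrite /P xgcF xgcbF !in_sep_flipr (negPf zx) (negPf zg) (negPf zc) /=.
    rewrite (sep_fliprU cgx') (sep_fliprU gx') !subUset !sub1set sub.
    by rewrite subv !in_setD1 guv gb cuv cb.
  rewrite (sep_fliprU cgx') cardsU1 cgx' (sep_fliprU gx') cardsU1 gx' /=.
  by rewrite !add1n ltnNge leqnSn.
(* If [z] were flipped second, [x ^^ b ^^ z] would be [v]; since [v ^^ b] is in [F], this would be a
   square at [x]. *)
have xbzF : z == c -> v = x ^^ b ^^ z.
  move=> /eqP zc; apply: esym; apply: min; first by rewrite zc.
  - have zxb : z \notin sep u (x ^^ b) by rewrite in_sep_flipr (negPf zx) (negPf zb).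
    by rewrite (sep_fliprU zxb) (sep_fliprU bx) !subUset !sub1set buv zuv subx.
  - by rewrite !in_sep_flipr (negPf bx) eqxx (negPf bz).
  - by rewrite !in_sep_flipr (negPf zx) eqxx (negPf zb).
have {}zgc : z = g.
  case/orP: zgc => [/eqP // | zc]; have xv := xbzF zc.
  have xzF : x ^^ z \in F by move: vbF; rewrite xv flipC flipK.
  by have := nosq bz xF xbF xzF; rewrite -xv vF.
subst g; case: (eqVneq x u) => [xu | xu].
  by subst x; exists c; split.
have lt : #|sep u x| <= n.
  rewrite -ltnS; apply: leq_trans len; apply: proper_card; apply/properP.
  by split=> //; exists b.
(* The first hexagon of the zone of [b] from [u] towards [x] also reaches the zone of [z], by
   induction, so its label [d] serves both edges at [u]. *)
have [|g [d [gux dux dg [ugF ugdF _ ubdF]]]] := zone_step uF ubF xF xbF _ bx.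
  by rewrite eq_sym.
have ugdzF := IHz u x z g d uF uzF xF xgF zx lt gux dux dg ugF ugdF.
have gz : z != g by apply: contraNneq zx => ->.
have dz : d != z by apply: contraNneq zx => <-.
exists d; split=> //.
- exact: (subsetP subx).
- by apply: contraNneq bx => <-.
- exact: (zone_label gz dg uF uzF ugF ugdzF).
Qed.

(** Of two continuations [c] and [h] of the edge [f], the one on the zone of [b] pulls the other
    onto it. A hexagon at [u ^^ f] and induction from [u ^^ f ^^ c], which is closer to [v], give a
    zone edge that [zone_transfer] brings back. *)
Lemma zone_interval_common u v b f c h n : diverging_edges n -> zone_intervals n ->
  u \in F -> u ^^ b \in F -> v \in F -> v ^^ b \in F -> b \notin sep u v ->
  #|sep u v| <= n.+1 -> f \in sep u v -> h \in sep u v -> h != f ->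
  u ^^ f \in F -> u ^^ f ^^ h \in F ->
  c \in sep u v -> c != f -> u ^^ f ^^ c \in F -> u ^^ f ^^ c ^^ b \in F ->
  u ^^ f ^^ h ^^ b \in F.
Proof.
move=> IHd IHz uF ubF vF vbF buv len fuv huv hf ufF ufhF cuv cf ufcF ufcbF.
have [->//|hc] := eqVneq h c.
have sf := card_sep_flip fuv.
have cufv : c \in sep (u ^^ f) v by rewrite in_sep_flip cuv (negPf cf).
have hufv : h \in sep (u ^^ f) v by rewrite in_sep_flip huv (negPf hf).
have [|k [kv kh kc fhkF fckF]] := IHd (u ^^ f) v h c ufF vF _ hufv cufv hc ufhF ufcF.
  by rewrite -ltnS -sf.
have bf : b != f by apply: contraNneq buv => ->.
have bc : b != c by apply: contraNneq buv => ->.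
have bh : b != h by apply: contraNneq buv => ->.
have kf : k != f.
  by apply: contraTneq kv => ->; rewrite in_sep_flip fuv eqxx.
have kuv : k \in sep u v by move: kv; rewrite in_sep_flip (negPf kf) addbF.
have bk : b != k by apply: contraNneq buv => ->.
have chk : c != k by rewrite eq_sym.
have fckhF : u ^^ f ^^ c ^^ k ^^ h \in F.
  by rewrite flipC (flipC (u ^^ f)) (hexagon hc) // 1?eq_sym.
have khbF : u ^^ f ^^ c ^^ k ^^ h ^^ b \in F.
  apply: (IHz (u ^^ f ^^ c) v b k h) => //.
  - by rewrite !in_sep_flip (negPf buv) (negPf bf) (negPf bc).
  - by rewrite -ltnS -(card_sep_flip cufv) leqW // -ltnS -sf.
  - by rewrite !in_sep_flip kuv (negPf kf) (negPf kc).
  - by rewrite !in_sep_flip huv (negPf hf) (negPf hc).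
  - by rewrite eq_sym.
rewrite -(flipK (u ^^ f) c).
apply: (@zone_transfer _ b k c h) => //; rewrite ?flipK //; try by rewrite eq_sym.
Qed.

(** The edge given by [zone_step] starts with some label [g]. A hexagon on [f] and [g] transfers it
    beyond [f]; [zone_interval_common] is used once beyond [g] and once beyond [f]. *)
Lemma zone_intervalsS n : diverging_edges n -> zone_intervals n ->
  diverging_edges n.+1 -> zone_intervals n.+1.
Proof.
move=> IHd IHz IHd1 u v b f h uF ubF vF vbF buv len fuv huv hf ufF ufhF.
have uv : u != v by apply: contraTneq fuv => ->; rewrite sepAA inE.
have [g [c [guv cuv cg [ugF ugcF ugcbF _]]]] := zone_step uF ubF vF vbF uv buv.
have common := zone_interval_common IHd IHz uF ubF vF vbF buv len.
have [fg|fg] := eqVneq f g; first by subst g; apply: (common f c).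
have [k [kuv kf kg ufkF ugkF]] := IHd1 u v f g uF vF len fuv guv fg ufF ugF.
have ugkbF : u ^^ g ^^ k ^^ b \in F by apply: (common g c).
apply: (common f k) => //.
have bn i : i \in sep u v -> b != i by move=> iuv; apply: contraNneq buv => ->.
by apply: (zone_transfer (bn g guv) (bn f fuv) _ kg kf uF) => //; rewrite eq_sym bn.
Qed.

Lemma interval_props n : diverging_edges n /\ zone_intervals n.
Proof.
elim: n => [|n [IHd IHz]].
  by split=> [u v b z _ _|u v b f h _ _ _ _ _];
    rewrite leqn0 cards_eq0 => /eqP->; rewrite inE.
have IHd1 := diverging_edgesS IHd IHz.
by split=> //; apply: zone_intervalsS.
Qed.

(** * Minimal halfspaces *)

(** Label and side form one argument, so that a smallest halfspace is chosen over both at once. *)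
Definition halfspace (p : L * bool) := [set w in F | (p.1 \in w) == p.2].

Lemma minimal_halfspace_edge u0 b0 : u0 \in F -> u0 ^^ b0 \in F ->
  exists u b, [/\ u \in F, u ^^ b \in F & forall i j, i != b -> j != i ->
    u ^^ i \in F -> u ^^ i ^^ j \in F -> u ^^ b ^^ j \in F].
Proof.
move=> u0F u0bF.
pose proper_half p := (0 < #|halfspace p|) && (0 < #|halfspace (p.1, ~~ p.2)|).
have P0 : proper_half (b0, b0 \in u0).
  rewrite /proper_half; apply/andP; split; apply/card_gt0P.
    by exists u0; rewrite inE u0F eqxx.
  by exists (u0 ^^ b0); rewrite !inE u0bF eqxx addbT eqxx.
case: (arg_minnP (fun p => #|halfspace p|) P0) => -[b s] /andP[] /=.
move=> /card_gt0P[w1]; rewrite inE /= => /andP[w1F /eqP w1s].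
move=> /card_gt0P[w2]; rewrite inE /= => /andP[w2F /eqP w2s] hmin.
have [|u [uF ubF sub]] := crossing_edge w1F w2F (b := b).
  by rewrite inE w1s w2s; case: (s).
have us : (b \in u) = s.
  have: b \notin sep w1 u by apply/negP=> /(subsetP sub); rewrite !inE eqxx.
  by rewrite inE w1s; case: (s); case: (b \in u).
exists u, b; split=> // i j ib ji uiF uijF.
have bi : b != i by rewrite eq_sym.
have jb : j != b.
  apply: contraTneq uijF => ->; rewrite flipC.
  exact: (nosq bi uF ubF uiF).
(* It suffices to put [u ^^ i ^^ j] on the zone of [b]. Otherwise its side of the label [j] turns
   out to be a smaller halfspace. *)
apply: (zone_label bi ji uF ubF uiF); apply: contraT => yb.
have [t yt] : exists t, (j \in u ^^ i ^^ j) = t by eexists.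
have tu : t = (j \notin u) by rewrite -yt !in_flip eqxx (negPf ji) addbF addbT.
have hj : halfspace (j, t) \proper halfspace (b, s).
  apply/properP; split; last first.
    exists u; first by rewrite inE uF us eqxx.
    by rewrite inE uF tu /=; case: (j \in u).
  apply/subsetP=> z; rewrite !inE => /andP[zF /eqP zj]; rewrite zF /=.
  apply: contraT => zs.
  have ys : (b \in u ^^ i ^^ j) = s.
    by rewrite !in_flip (negPf bi) (eq_sym b) (negPf jb) !addbF.
  (* A vertex [z] on this side of [j] but beyond [b] yields an edge of the zone at [z1], where [z1]
     is separated from [u] by [j] and not by [b]. *)
  have [|z1 [z1F z1bF {}sub]] := crossing_edge uijF zF (b := b).
    by rewrite in_sep ys; move: zs; case: (s); case: (b \in z).
  have byz : b \notin sep (u ^^ i ^^ j) z1 by apply/negP=> /(subsetP sub); rewrite !inE eqxx.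
  have jyz : j \notin sep (u ^^ i ^^ j) z1.
    apply/negP=> /(subsetP sub); rewrite in_setD1 => /andP[_].
    by rewrite in_sep zj yt addbb.
  have buz : b \notin sep u z1.
    by move: byz; rewrite !in_sep_flip (negPf bi) (eq_sym b) (negPf jb) !addbF.
  have juz : j \in sep u z1.
    by move: jyz; rewrite !in_sep_flip eqxx (negPf ji) addbF addbT negbK.
  (* The bound covers the intervals to [z1] from [u ^^ i] and from [u]. *)
  have [diverging closed] := interval_props #|sep (u ^^ i) z1|.+1.
  have len : #|sep u z1| <= #|sep (u ^^ i) z1|.+1.
    have [iuz|iuz] := boolP (i \in sep u z1); first by rewrite (card_sep_flip iuz).
    by rewrite leqW // !(sepC _ z1) sep_fliprU ?subset_leq_card ?subsetUr // sepC.
  have {}closed f h := closed u z1 b f h uF ubF z1F z1bF buz len.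
  have [iuz|iuz] := boolP (i \in sep u z1).
    by rewrite closed in yb.
  (* Here [i] points away from [z1]. A hexagon at [u ^^ i] replaces it by a label [c] pointing
     towards [z1], and the zone edge found beyond [c] is transferred back to [i]. *)
  have imz : i \in sep (u ^^ i) z1 by rewrite in_sep_flip (negPf iuz) eqxx.
  have jmz : j \in sep (u ^^ i) z1 by rewrite in_sep_flip juz (negPf ji).
  have [||c [cmz ci cj]] := diverging _ _ i j uiF z1F (leqnSn _) imz jmz _ _ uijF.
  - by rewrite eq_sym.
  - by rewrite flipK.
  rewrite flipK => ucF uijcF.
  have cuz : c \in sep u z1 by move: cmz; rewrite in_sep_flip (negPf ci) addbF.
  have bc : b != c by apply: contraNneq buz => ->.
  have ij : i != j by rewrite eq_sym.
  have ucjF : u ^^ c ^^ j \in F.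
    have := hexagon ij ci cj uiF _ uijF _ uijcF; rewrite !flipK.
    by rewrite -(flipC _ j) => ->.
  have jc : j != c by rewrite eq_sym.
  have ucjbF := closed c j cuz juz jc ucF ucjF.
  by case/negP: yb; apply: (zone_transfer bc bi jb jc ji uF ubF ucF ucjbF).
have := leq_ltn_trans (hmin (j, t) _) (proper_card hj); rewrite ltnn; apply.
rewrite /proper_half; apply/andP; split; apply/card_gt0P.
  by exists (u ^^ i ^^ j); rewrite inE uijF yt eqxx.
by exists (u ^^ i); rewrite inE uiF tu /= in_flip (negPf ji) addbF negbK eqxx.
Qed.

(** * Middle levels *)

Definition nbrs u := [set i | u ^^ i \in F].

(** When [u] is a [k]-subset in the middle levels, [nbrs u] is that subset and [Y] its complement: a
    neighbour can restore its lost element or add one from [Y]. *)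
Definition spoke u (Y : {set L}) := [/\ u \in F, [disjoint nbrs u & Y] &
  forall i, i \in nbrs u -> nbrs (u ^^ i) = i |: Y].

Variable k : nat.
Hypothesis regF : forall u, u \in F -> #|nbrs u| = k.

Lemma in_nbrs u i : (i \in nbrs u) = (u ^^ i \in F).
Proof. by rewrite inE. Qed.

Lemma nbrs_flip u i : u \in F -> i \in nbrs (u ^^ i).
Proof. by rewrite in_nbrs flipK. Qed.

(** Each neighbour of [u] has [k.-1] labels besides the one leading back, so the inclusion coming
    from the hypothesis is an equality. *)
Lemma spoke_edge u b : u \in F -> u ^^ b \in F ->
  (forall i j, i != b -> j != i -> u ^^ i \in F -> u ^^ i ^^ j \in F ->
     u ^^ b ^^ j \in F) ->
  spoke u (nbrs (u ^^ b) :\ b).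
Proof.
move=> uF ubF closed; split=> // [|i].
  rewrite disjoint_sym; apply/pred0P=> j /=; apply/negbTE.
  rewrite in_setD1 !in_nbrs -andbA; apply/and3P=> -[jb ubjF ujF].
  by have := nosq jb uF ujF ubF; rewrite flipC ubjF.
rewrite in_nbrs => uiF; have [->|ib] := eqVneq i b.
  by rewrite setD1K ?nbrs_flip.
rewrite -(setD1K (nbrs_flip i uF)); congr (_ |: _); apply/eqP.
have cardD j : u ^^ j \in F -> #|nbrs (u ^^ j) :\ j| = k.-1.
  by move=> ujF; rewrite -(regF ujF) [in RHS](cardsD1 j) nbrs_flip.
rewrite eqEcard !cardD // leqnn andbT; apply/subsetP=> j.
rewrite !in_setD1 !in_nbrs => /andP[ji uijF]; rewrite (closed i j) // andbT.
by apply: contraTneq uijF => ->; apply: (nosq ib).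
Qed.

Lemma card_spoke u Y i : spoke u Y -> i \in nbrs u -> #|Y| = k.-1.
Proof.
move=> [uF dis sp] iu; move: (iu); rewrite in_nbrs => /regF <-.
by rewrite sp // cardsU1 (disjointFr dis iu).
Qed.

(** For [j] in [Y], [hexagon] makes each label of [u] other than [i] a label of [u ^^ i ^^ j]. With
    [j] itself these are already [k] labels. *)
Lemma spoke_step u Y i : spoke u Y -> i \in nbrs u -> spoke (u ^^ i) (nbrs u :\ i).
Proof.
move=> uY iu; have [uF dis sp] := uY; split; first by rewrite -in_nbrs.
  rewrite sp //; apply/pred0P=> j /=; rewrite in_setU1 in_setD1.
  by case: eqVneq => //= _; apply/negbTE/andP=> -[jY]; rewrite (disjointFl dis jY).
move=> j; rewrite sp // in_setU1; have [-> _|ji /= jY] := eqVneq j i.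
  by rewrite flipK setD1K.
have uijF : u ^^ i ^^ j \in F by rewrite -in_nbrs sp // in_setU1 jY orbT.
have ju := disjointFl dis jY.
apply/esym/eqP; rewrite eqEcard; apply/andP; split; last first.
  rewrite (regF uijF) cardsU1 in_setD1 ju andbF /= -(regF uF).
  by rewrite (cardsD1 i (nbrs u)) iu.
rewrite subUset sub1set nbrs_flip -?in_nbrs //=.
apply/subsetP=> l; rewrite in_setD1 => /andP[li lu].
have jl : j != l by apply: contraFneq ju => ->.
have il : i != l by rewrite eq_sym.
rewrite in_nbrs flipC; apply: hexagon => //; rewrite -in_nbrs //.
by rewrite sp // in_setU1 jY orbT.
Qed.

Lemma middle_levels u Y i : spoke u Y -> i \in nbrs u ->
  exists M a : {set L}, #|M| = (2 * k).-1 /\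
    forall A, (sep A a \in F) = (A \subset M) && ((#|A| == k.-1) || (#|A| == k)).
Proof.
move=> uY iu; have [uF dis sp] := uY.
have k0 : 0 < k by rewrite -(regF uF); apply/card_gt0P; exists i.
pose X := nbrs u; pose M := X :|: Y; pose a := sep u X.
have cM : #|M| = (2 * k).-1.
  rewrite cardsU (card_spoke uY iu) (regF uF) (disjoint_setI0 dis) cards0 subn0.
  by rewrite mul2n -addnn -[in RHS](prednK k0) addnS prednK.
have sepa w j : sep (w ^^ j) a = sep w a ^^ j.
  by apply/setP=> x; rewrite in_sep_flip in_flip.
(* The alternatives of the last clause are the two sizes: from a [k]-subset the labels remove
   elements, from a [k.-1]-subset they add the missing ones. *)
pose good w := [/\ nbrs w \subset M, spoke w (M :\: nbrs w) &
  sep w a = nbrs w \/ sep w a = M :\: nbrs w].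
have good_step w j : good w -> j \in nbrs w -> good (w ^^ j).
  move=> [sub wY sw] jw; have [_ _ spw] := wY; have nw := spw j jw.
  have jM := subsetP sub _ jw.
  have D : M :\: nbrs (w ^^ j) = nbrs w :\ j.
    apply/setP=> x; rewrite nw !inE negb_or negb_and negbK.
    have [->|_] //= := eqVneq x j.
    have := subsetP sub x; rewrite !inE; case: (w ^^ x \in F) => //= [->//|_].
    by rewrite andNb.
  split.
  - by rewrite nw subUset sub1set jM subsetDl.
  - by rewrite D; apply: spoke_step wY jw.
  rewrite sepa D nw; case: sw => ->; [right|left]; apply/setP=> x; rewrite !inE.
    by have [->|] := eqVneq x j; rewrite ?addbF // -in_nbrs jw.
  by have [->|] := eqVneq x j; rewrite ?addbF // -in_nbrs jw.
have good_u : good u.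
  have D : M :\: X = Y.
    by rewrite setDUl setDv set0U; apply/setDidPl; rewrite disjoint_sym.
  split; [exact: subsetUl | by rewrite D | left].
  by apply/setP=> x; rewrite !inE; do 2!case: (_ \in _).
have all_good w : w \in F -> good w.
  have [n] := ubnP #|sep w u|; elim: n w => // n IHn w le wF.
  have [->//|wu] := eqVneq w u; have [j jw wjF] := isoF wF uF wu.
  rewrite -(flipK w j); apply: good_step; last by rewrite in_nbrs flipK.
  by apply: IHn => //; rewrite -ltnS -(card_sep_flip jw).
have sepaK A : sep (sep A a) a = A.
  by apply/setP=> x; rewrite !in_sep -addbA addbb addbF.
have cD w : w \in F -> good w -> #|M :\: nbrs w| = k.-1.
  move=> wF [sub _ _]; rewrite cardsD (setIidPr sub) cM (regF wF) mul2n -addnn.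
  by rewrite -subn1 -subnDA addnC subnDA addnK subn1.
exists M, a; split=> // A; apply/idP/idP=> [AF | /andP[AM cA]].
  have gA := all_good _ AF; have [sub _ sA] := gA.
  have := cD _ AF gA; have := regF AF; move: sA sub; rewrite sepaK.
  by case=> eA {}sub c1 c2; rewrite eA ?sub ?subsetDl ?c1 ?c2 eqxx ?orbT.
(* Conversely, [A] is led to [X] through the two sizes, by adding an element of [X] to a small set
   or removing an element outside [X] from a large one. *)
have [n] := ubnP #|sep A X|; elim: n A AM cA => // n IHn A AM cA le.
have [->|AX] := eqVneq A X.
  rewrite (_ : sep X a = u) //.
  by apply/setP=> x; rewrite !in_sep; do 2!case: (_ \in _).
have cX : #|X| = k by apply: regF.
have XM : X \subset M by apply: subsetUl.
(* The last clause says that the flip of [j] from [A ^^ j] back to [A] is one of the flips allowed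
   by the size of [A ^^ j]. *)
have [j [jAX jM cAj]] : exists j, [/\ j \in sep A X, j \in M &
    (#|A ^^ j| == k.-1) && (j \notin A ^^ j) || (#|A ^^ j| == k) && (j \in A ^^ j)].
  case/orP: cA => /eqP cA.
    have /subsetPn[j jX jA] : ~~ (X \subset A).
      by apply/negP=> /subset_leq_card; rewrite cX cA leqNgt prednK ?leqnn.
    exists j; split; rewrite ?in_sep ?jX ?(negPf jA) //; first exact: (subsetP XM).
    have -> : A ^^ j = j |: A.
      by apply/setP=> x; rewrite !inE; case: eqVneq => [->|]; rewrite ?(negPf jA) ?addbF.
    by rewrite cardsU1 jA cA add1n prednK // !inE !eqxx orbT.
  have /subsetPn[j jA jX] : ~~ (A \subset X).
    by apply: contra AX => sub; rewrite eqEcard sub cX cA /=.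
  exists j; split; rewrite ?in_sep ?jA ?(negPf jX) //; first exact: (subsetP AM).
  have -> : A ^^ j = A :\ j.
    by apply/setP=> x; rewrite !inE; case: eqVneq => [->|]; rewrite ?jA ?addbF.
  by rewrite -cA [in X in _ == X.-1](cardsD1 j) jA eqxx !inE eqxx.
have AjM : A ^^ j \subset M.
  apply/subsetP=> x; rewrite in_flip; have [->//|_] := eqVneq x j.
  by rewrite addbF; apply: (subsetP AM).
have AjF : sep (A ^^ j) a \in F.
  apply: IHn => //; last by rewrite -ltnS -(card_sep_flip jAX).
  by case/orP: cAj => /andP[-> _]; rewrite ?orbT.
suff: j \in nbrs (sep (A ^^ j) a) by rewrite in_nbrs sepa flipK.
have gA := all_good _ AjF; have [_ _ sA] := gA; rewrite sepaK in sA.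
have := cD _ AjF gA; have := regF AjF.
have k1 : k != k.-1 by rewrite -{1}(prednK k0) gtn_eqF.
case: sA cAj => eA cAj c1 c2.
  move: cAj; rewrite {1 3}eA c1 (negPf k1) /= => /andP[_]; by rewrite {1}eA.
move: cAj; rewrite {1 3}eA c2 (eq_sym k.-1) (negPf k1) orbF => /andP[_].
by rewrite {1}eA in_setD jM andbT negbK.
Qed.

End Family.

(** * Successors in a cyclic sequence *)

Lemma next_nth_uniq (T : eqType) (x0 : T) c i : uniq c -> i.+1 < size c ->
  next c (nth x0 c i) = nth x0 c i.+1.
Proof.
case: c => // x c Uc lt; have lti := ltnW lt.
rewrite next_nth mem_nth // index_uniq //=.
exact: set_nth_default.
Qed.

Lemma next_last (T : eqType) (x : T) c : uniq (x :: c) -> next (x :: c) (last x c) = x.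
Proof.
move=> Uc; rewrite next_nth mem_last.
by rewrite (last_nth x) index_uniq //= nth_default.
Qed.

(** * Sets of the two middle sizes and the Doubled Odd graph *)

Lemma card_flip (L : finType) (A : {set L}) i :
  #|A ^^ i| = if i \in A then #|A|.-1 else #|A|.+1.
Proof.
case: ifP => iA.
  have -> : A ^^ i = A :\ i.
    by apply/setP=> x; rewrite !inE; case: eqVneq => [->|]; rewrite ?iA ?addbF.
  by rewrite [in RHS](cardsD1 i) iA.
have -> : A ^^ i = i |: A.
  by apply/setP=> x; rewrite !inE; case: eqVneq => [->|]; rewrite ?iA ?addbF.
by rewrite cardsU1 iA.
Qed.

Definition mid_size (L : finType) k (A : {set L}) := (#|A| == k.-1) || (#|A| == k).

Lemma mid_flip (L : finType) k (A : {set L}) i : 0 < k ->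
  mid_size k A -> mid_size k (A ^^ i) -> (i \in A) = (#|A| == k).
Proof.
move=> k0; rewrite /mid_size card_flip; case: ifP => iA.
  have : 0 < #|A| by apply/card_gt0P; exists i.
  by lia.
by lia.
Qed.

Lemma mid_flip_size (L : finType) k (A : {set L}) i : 0 < k ->
  mid_size k A -> mid_size k (A ^^ i) -> (#|A ^^ i| == k) = (#|A| != k).
Proof.
move=> k0; rewrite /mid_size card_flip; case: ifP => iA; last by lia.
have : 0 < #|A| by apply/card_gt0P; exists i.
by lia.
Qed.

Lemma mid_adj (L : finType) k (A B : {set L}) : 0 < k -> mid_size k A -> mid_size k B ->
  (#|sep A B| == 1) = [&& #|A| == k.-1, #|B| == k & A \subset B] ||
                      [&& #|B| == k.-1, #|A| == k & B \subset A].
Proof.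
move=> k0 mA mB.
have card_sub (C E : {set L}) :
    #|C| = k.-1 -> #|E| = k -> C \subset E -> #|sep C E| = 1.
  move=> cC cE CE; have -> : sep C E = E :\: C.
    apply/setP=> x; rewrite !inE; move: (subsetP CE x).
    by case: (x \in C) => // ->.
  by rewrite cardsD (setIidPr CE) cC cE -{1}(prednK k0) subSnn.
apply/idP/orP=> [/cards1P[i /sep1 BE] | [] /and3P[/eqP c1 /eqP c2 sub]]; last 2 first.
- by rewrite card_sub.
- by rewrite sepC card_sub.
rewrite BE in mB *; have := mid_flip k0 mA mB; rewrite card_flip.
case: ifP => iA /esym/eqP cA; [right | left].
  rewrite cA !eqxx; apply/subsetP=> x; rewrite in_flip.
  by case: eqVneq => [->|]; rewrite ?iA ?addbF.
have {}cA : #|A| = k.-1 by apply/eqP; case/orP: mA => // /eqP.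
rewrite cA (prednK k0) !eqxx; apply/subsetP=> x; rewrite in_flip.
by case: eqVneq => [->|]; rewrite ?iA ?addbF.
Qed.

(** Sizes alternate along the path, so the flips [a] and [c] are of the same kind and [b] of the
    opposite one. Performing them in the order [c], [b], [a] gives the other half of the hexagon. *)
Lemma dodd_three_paths (T : finType) (e : rel T) k : 0 < k ->
  graph_iso e (@dodd_adj k) -> three_paths_in_6cycles e.
Proof.
move=> k0 [h [[h' hK h'K] he]] q [Uq sq [x0 [p [qE xp]]]]; subst q.
case: p Uq sq xp => [|x1 [|x2 [|x3 [|//]]]] // Uq _ xp.
have mid x : mid_size k (val (h x)) by apply: (valP (h x)).
have adj x y : e x y = (#|sep (val (h x)) (val (h y))| == 1).
  by rewrite he (mid_adj k0 (mid x) (mid y)).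
have edge x y : e x y -> exists i, val (h y) = val (h x) ^^ i.
  by rewrite adj => /cards1P[i /sep1 ->]; exists i.
have neq k1 k2 : k1 < 4 -> k2 < 4 ->
    (nth x0 [:: x0; x1; x2; x3] k1 == nth x0 [:: x0; x1; x2; x3] k2) = (k1 == k2).
  by move=> ? ?; apply: nth_uniq.
have h_inj x y : val (h x) = val (h y) -> x = y by move/val_inj/(can_inj hK).
case/and4P: (xp) => /edge[a E1] /edge[b E2] /edge[c E3] _.
have ab : a != b.
  by apply: contraFneq (neq 0 2 isT isT) => ab; apply/eqP/h_inj; rewrite /= E2 E1 ab flipK.
have bc : b != c.
  by apply: contraFneq (neq 1 3 isT isT) => bc; apply/eqP/h_inj; rewrite /= E3 E2 bc flipK.
set V := val (h x0) in E1.
have mV : mid_size k V := mid x0.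
have m1 : mid_size k (V ^^ a) by rewrite -E1 mid.
have m2 : mid_size k (V ^^ a ^^ b) by rewrite -E1 -E2 mid.
have m3 : mid_size k (V ^^ a ^^ b ^^ c) by rewrite -E1 -E2 -E3 mid.
have va := mid_flip k0 mV m1; have vb := mid_flip k0 m1 m2.
have vc := mid_flip k0 m2 m3; have s1 := mid_flip_size k0 mV m1.
rewrite s1 -va in vb; rewrite (mid_flip_size k0 m1 m2) s1 -va negbK in vc.
have ac : a != c.
  apply/eqP=> ac; move: vc; rewrite -ac !in_flip eqxx (negPf ab) addbF addbT.
  by case: (a \in V).
have vc' : (c \in V) = (a \in V).
  by rewrite -vc !in_flip (eq_sym c) (negPf ac) (eq_sym c) (negPf bc) !addbF.
have cc : #|V ^^ c| = #|V ^^ a| by rewrite !card_flip vc'.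
have mc : mid_size k (V ^^ c) by rewrite /mid_size cc.
have mcb : mid_size k (V ^^ c ^^ b).
  have vb' : (b \in V) = (a \notin V) by rewrite -vb in_flip eq_sym (negPf ab) addbF.
  move: m2; rewrite /mid_size card_flip vb.
  by rewrite (card_flip (V ^^ c)) cc in_flip (negPf bc) addbF vb'.
have {}E2 : val (h x2) = V ^^ a ^^ b by rewrite E2 E1.
have {}E3 : val (h x3) = V ^^ a ^^ b ^^ c by rewrite E3 E2.
have flip_adj x y i : val (h y) = val (h x) ^^ i -> e x y.
  by move=> yE; rewrite adj yE sep_flip cards1.
pose y5 := h' (exist _ (V ^^ c) mc); pose y4 := h' (exist _ (V ^^ c ^^ b) mcb).
have E5 : val (h y5) = V ^^ c by rewrite h'K.
have E4 : val (h y4) = V ^^ c ^^ b by rewrite h'K.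
exists [:: x0; x1; x2; x3; y4; y5]; split; last first.
  by split=> //; exists 0; left; rewrite rot0.
apply/and3P; split=> //.
  apply: (@map_uniq _ _ (fun x => val (h x))).
  (* Membership of [a], [b] and [c] alone tells the six vertices apart. *)
  apply: (@map_uniq _ _ (fun B : {set 'I_(2 * k).-1} => (a \in B, b \in B, c \in B))).
  rewrite /= -[sval (h x0)]/V (E5 : sval (h y5) = _) (E4 : sval (h y4) = _).
  rewrite (E3 : sval (h x3) = _) (E2 : sval (h x2) = _) (E1 : sval (h x1) = _).
  rewrite !in_flip !eqxx !(eq_sym b a) !(eq_sym c a) !(eq_sym c b).
  rewrite (negPf ab) (negPf ac) (negPf bc) !addbF !addbT.
  by case: (a \in V); case: (b \in V); case: (c \in V).
have e34 : e x3 y4.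
  by apply: (flip_adj _ _ a); rewrite E4 E3 (flipC _ b c) (flipC V a c) (flipC _ a b) flipK.
have e45 : e y4 y5 by apply: (flip_adj _ _ b); rewrite E4 E5 flipK.
have e50 : e y5 x0 by apply: (flip_adj _ _ c); rewrite E5 flipK.
by case/and4P: xp => e01 e12 e23 _; rewrite /= e01 e12 e23 e34 e45 e50.
Qed.

(** * Graphs embedded in a hypercube *)

Section Embedding.
Variables (T : finType) (e : rel T) (n : nat) (f : T -> {ffun 'I_n -> bool}).
Hypotheses (e_sym : symmetric e) (e_irr : irreflexive e).
Hypothesis f_dist : forall u v, is_dist e u v (hamming (f u) (f v)).
Implicit Types (u v w x y : T) (p q c r : seq T) (b : 'I_n).

Definition label_set u := [set i | f u i].
Definition vertex_sets := [set label_set u | u : T].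

Local Notation D u v := (sep (label_set u) (label_set v)).

Lemma hamming_sep u v : hamming (f u) (f v) = #|D u v|.
Proof.
congr #|pred_of_set _|; apply/setP=> i; rewrite !inE.
by do 2!case: (f _ i).
Qed.

Lemma dist_sep u v d : is_dist e u v d -> d = #|D u v|.
Proof.
rewrite -hamming_sep => -[wd dmin]; have [wh hmin] := f_dist u v.
by apply/eqP; rewrite eqn_leq dmin // hmin.
Qed.

Lemma card_sep_path u p : path e u p -> #|D u (last u p)| <= size p.
Proof.
move=> up; rewrite -hamming_sep; have [_] := f_dist u (last u p); apply.
by exists p; rewrite up !eqxx.
Qed.

Lemma label_set_inj : injective label_set.
Proof.
move=> u v uv; have [[[|w p] /and3P[_ /eqP lp]]] := f_dist u v; first by [].
by rewrite hamming_sep uv sepAA cards0.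
Qed.

Lemma geodesic_path u v : exists p, [/\ path e u p, last u p = v & size p = #|D u v|].
Proof.
have [[p /and3P[up /eqP lp /eqP sp]] _] := f_dist u v.
by exists p; split; rewrite // sp hamming_sep.
Qed.

Lemma edge_sep u v : e u v = (#|D u v| == 1).
Proof.
apply/idP/idP=> [uv|/eqP uv].
  have le : #|D u v| <= 1 by apply: (@card_sep_path u [:: v]); rewrite /= uv.
  rewrite eqn_leq le lt0n cards_eq0 sep_eq0.
  by apply: contraTneq uv => /label_set_inj->; rewrite e_irr.
have [p [up lp sp]] := geodesic_path u v; rewrite uv in sp.
by case: p sp up lp => [|w [|//]] //= _; rewrite andbT => ? <-.
Qed.

Lemma edge_flip u v : e u v -> exists i, label_set v = label_set u ^^ i.
Proof. by rewrite edge_sep => /cards1P[i] /sep1 uv; exists i. Qed.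

Lemma flip_edge u v i : label_set v = label_set u ^^ i -> e u v.
Proof. by move=> uv; rewrite edge_sep uv sep_flip cards1. Qed.

Lemma label_setF u : label_set u \in vertex_sets.
Proof. exact: imset_f. Qed.

Lemma vertex_setP A : reflect (exists u, A = label_set u) (A \in vertex_sets).
Proof. by apply: (iffP imsetP) => [[u _ ->]|[u ->]]; exists u. Qed.

Lemma vertex_sets_iso A B : A \in vertex_sets -> B \in vertex_sets -> A != B ->
  exists2 i, i \in sep A B & A ^^ i \in vertex_sets.
Proof.
move=> /vertex_setP[u ->] /vertex_setP[v ->] uv.
have [[|w p] [/= up lp sp]] := geodesic_path u v; first by rewrite lp eqxx in uv.
case/andP: up => /edge_flip[i wi] wp; exists i; last by rewrite -wi label_setF.
(* If the first label of the geodesic were outside the difference, the rest would be too short for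
   the distance left. *)
apply: contraT => iuv; have := card_sep_path wp.
rewrite sepC in iuv; rewrite lp wi sepC sep_fliprU // cardsU1 iuv sepC -sp.
by rewrite add1n ltnNge leqnSn.
Qed.

Lemma card_nbrs u : #|nbrs vertex_sets (label_set u)| = #|[set v | e u v]|.
Proof.
have eqA : [set label_set v | v in [set v | e u v]] =
    [set label_set u ^^ i | i in nbrs vertex_sets (label_set u)].
  apply/setP=> A; apply/imsetP/imsetP=> -[z]; rewrite inE.
    move=> uz ->; have [i zi] := edge_flip uz.
    by exists i; rewrite // inE -zi label_setF.
  by move=> /vertex_setP[v zv] ->; exists v; rewrite // inE; apply: flip_edge (esym zv).
rewrite -(card_imset _ label_set_inj) eqA card_imset //; exact: flip_inj.
Qed.

(** The difference of the ends is covered by those of the two parts, and the length of a geodesic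
    leaves no room for a label common to both. *)
Lemma geodesic_sub u p w : path e u p -> size p = #|D u (last u p)| -> w \in u :: p ->
  D u w \subset D u (last u p).
Proof.
move=> + + wp; case/splitPl: wp => p1 p2 w1; rewrite cat_path last_cat size_cat w1.
move=> /andP[up1 wp2] sz; have c1 := card_sep_path up1; have c2 := card_sep_path wp2.
rewrite w1 in c1; set v := last w p2 in sz c2 *.
have sub : D u v \subset D u w :|: D w v.
  by apply/subsetP=> i; rewrite in_setU (in_sep_mid (label_set w)); do 2!case: (_ \in _).
have : D u w :&: D w v = set0.
  apply/eqP; rewrite -cards_eq0 -leqn0 -(leq_add2l #|D u w :|: D w v|) cardsUI addn0.
  by rewrite (leq_trans (leq_add c1 c2)) // sz subset_leq_card.
move=> dis; apply/subsetP=> i iw; rewrite (in_sep_mid (label_set w)) iw /=.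
apply/negP=> iv; suff: i \in set0 by rewrite inE.
by rewrite -dis; apply/setIP.
Qed.

Lemma geodesic_nth u p (i : nat) : path e u p -> size p = #|D u (last u p)| ->
  i <= size p ->
  #|D u (nth u (u :: p) i)| = i.
Proof.
move=> up sz le; have eqw : nth u (u :: p) i = last u (take i p).
  rewrite (last_nth u) size_takel //; case: i le => // i le.
  by rewrite -[RHS]/(nth u (take i.+1 p) i) nth_take.
have up' := up; rewrite -(cat_take_drop i p) cat_path in up'; case/andP: up' => p1 p2.
rewrite eqw; apply/eqP; rewrite eqn_leq; apply/andP; split.
  by rewrite (leq_trans (card_sep_path p1)) // size_take_min geq_minl.
rewrite -(leq_add2r (size (drop i p))) -{1}(size_takel le) -size_cat cat_take_drop sz.
rewrite -{1}(cat_take_drop i p) last_cat.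
set w := last u _; apply: leq_trans (leq_add (leqnn _) (card_sep_path p2)).
rewrite -/w; set v := last w _; rewrite -cardsUI (leq_trans _ (leq_addr _ _)) //.
apply: subset_leq_card; apply/subsetP=> j.
by rewrite in_setU (in_sep_mid (label_set w)); do 2!case: (_ \in _).
Qed.

(** As each level has at most one vertex, a single geodesic exhausts the interval. *)
Lemma consecutive_nth b x y p w : label_set x ^^ b \in vertex_sets ->
  label_set y ^^ b \in vertex_sets -> consecutive vertex_sets b (label_set x) (label_set y) ->
  path e x p -> last x p = y -> size p = #|D x y| -> D x w \subset D x y ->
  w = nth x (x :: p) #|D x w|.
Proof.
move=> xbF ybF cons xp ly sp sub; have le : #|D x w| <= size p.
  by rewrite sp subset_leq_card.
apply: label_set_inj.
apply: (consecutive_level vertex_sets_iso xbF ybF cons); rewrite ?label_setF //.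
  by rewrite -ly geodesic_sub ?ly // mem_nth.
by rewrite geodesic_nth // sp ly.
Qed.

(** * The convex cycle through two consecutive edges of a zone *)

Section ZoneCycle.
Variables (b : 'I_n) (x xb y yb : T) (p q : seq T).
Hypotheses (xbE : label_set xb = label_set x ^^ b) (ybE : label_set yb = label_set y ^^ b).
Hypothesis xy : x != y.
Hypothesis cons_xy : consecutive vertex_sets b (label_set x) (label_set y).
Hypotheses (p_path : path e x p) (p_last : last x p = y) (p_size : size p = #|D x y|).
Hypotheses (q_path : path e yb q) (q_last : last yb q = xb) (q_size : size q = #|D yb xb|).

(** Near vertices are located by their distance from [x], far ones by their distance from [yb]; the
    edge from [xb] to [x] closes the cycle. *)
Let c := (x :: p) ++ (yb :: q).

Let b_xy : b \notin D x y. Proof. by case: cons_xy. Qed.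

Let far_sep : D yb xb = D x y.
Proof. by rewrite xbE ybE sep_flip_flip sepC. Qed.

Let near_nth w : D x w \subset D x y -> w = nth x c #|D x w|.
Proof.
move=> sub; rewrite nth_cat /= p_size ltnS subset_leq_card //.
apply: (consecutive_nth _ _ cons_xy p_path p_last p_size sub).
  by rewrite -xbE label_setF.
by rewrite -ybE label_setF.
Qed.

Let far_nth w : D yb w \subset D x y -> w = nth x c ((size p).+1 + #|D yb w|).
Proof.
rewrite -far_sep => sub; rewrite nth_cat /= ltnNge leq_addr /= addKn.
have := consecutive_opp cons_xy; rewrite -xbE -ybE => cons.
rewrite {1}(consecutive_nth _ _ cons q_path q_last q_size sub); last first.
- by rewrite xbE flipK label_setF.
- by rewrite ybE flipK label_setF.
by apply: set_nth_default; rewrite /= ltnS q_size subset_leq_card.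
Qed.

Let c_size : size c = (size p).+1 + (size p).+1.
Proof. by rewrite size_cat /= q_size far_sep -p_size. Qed.

Let near_lt w : D x w \subset D x y -> #|D x w| < (size p).+1.
Proof. by move=> sub; rewrite ltnS p_size subset_leq_card. Qed.

Let far_lt w : D yb w \subset D x y -> #|D yb w| < (size p).+1.
Proof. by move=> sub; rewrite ltnS p_size subset_leq_card. Qed.

Let far_sub w : (D yb w \subset D x y) = (D xb w \subset D x y).
Proof.
apply/idP/idP; apply: sep_sub_mid; first by rewrite far_sep.
by rewrite sepC far_sep.
Qed.

Let near_in w : w \in x :: p -> D x w \subset D x y.
Proof. by move=> wp; rewrite -p_last geodesic_sub // p_last. Qed.

Let far_in w : w \in yb :: q -> D yb w \subset D x y.
Proof. by move=> wq; rewrite -far_sep -q_last geodesic_sub // q_last. Qed.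

Let far_label w : D yb w \subset D x y -> b \in D x w.
Proof.
rewrite far_sub xbE => /subsetP/(_ b); rewrite in_sep_flip eqxx addbT.
by case: (b \in D x w) => // /(_ isT); rewrite (negPf b_xy).
Qed.

Let near_label w : D x w \subset D x y -> b \notin D x w.
Proof. by move=> sub; apply: contra b_xy; apply: (subsetP sub). Qed.

Let near_or_far w : D x w \subset b |: D x y ->
  D x w \subset D x y \/ D yb w \subset D x y.
Proof.
move=> sub; have [bw|bw] := boolP (b \in D x w); [right | left].
  rewrite far_sub xbE; apply/subsetP=> i; rewrite in_sep_flip.
  have [->|ib] := eqVneq i b; first by rewrite bw.
  by rewrite addbF => /(subsetP sub); rewrite in_setU1 (negPf ib).
apply/subsetP=> i iw; move: (subsetP sub i iw); rewrite in_setU1.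
by case/predU1P=> [ib|//]; rewrite ib (negPf bw) in iw.
Qed.

(** The cycle fills the whole interval from [x] to [yb], so it contains every geodesic between its
    vertices. *)
Let mem_c w : (w \in c) = (D x w \subset b |: D x y).
Proof.
apply/idP/idP.
  rewrite mem_cat => /orP[/near_in sub|/far_in].
    by rewrite (subset_trans sub) ?subsetUr.
  rewrite far_sub => /subsetP sub.
  apply/subsetP=> i iw; rewrite in_setU1; have [//|ib] := eqVneq i b.
  by apply: sub; rewrite xbE in_sep_flip iw (negPf ib).
case/near_or_far=> sub.
  by rewrite (near_nth sub) mem_nth // c_size ltn_addr ?near_lt.
by rewrite (far_nth sub) mem_nth // c_size ltn_add2l far_lt.
Qed.

Let c_uniq : uniq c.
Proof.
have near_level i : i <= size p -> #|D x (nth x (x :: p) i)| = i.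
  by apply: geodesic_nth; rewrite // p_last.
have far_level i : i <= size q -> #|D yb (nth yb (yb :: q) i)| = i.
  by apply: geodesic_nth; rewrite // q_last.
rewrite cat_uniq; apply/and3P; split.
- apply/(uniqP x) => i j; rewrite !inE /= !ltnS => ip jp ij.
  by rewrite -(near_level i ip) ij near_level.
- by apply/hasPn=> w /far_in/far_label bw; apply: contraL bw => /near_in/near_label.
- apply/(uniqP yb) => i j; rewrite !inE /= !ltnS => iq jq ij.
  by rewrite -(far_level i iq) ij far_level.
Qed.

Let x_xb : e x xb. Proof. exact: flip_edge xbE. Qed.
Let y_yb : e y yb. Proof. exact: flip_edge ybE. Qed.

Let c_cycle : is_cycle e c.
Proof.
apply/and3P; split=> //.
  rewrite c_size addSn addnS !ltnS addn_gt0 orbb p_size lt0n cards_eq0 sep_eq0.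
  by apply: contra xy => /eqP/label_set_inj->.
rewrite /c /= rcons_cat cat_path p_path p_last /= y_yb rcons_path q_path q_last.
by rewrite e_sym x_xb.
Qed.

Let next_c i w w' : i.+1 < size c -> w = nth x c i -> w' = nth x c i.+1 -> next c w = w'.
Proof. by move=> lt -> ->; apply: next_nth_uniq. Qed.

Let near_next w w' : D x w \subset D x y -> D x w' \subset D x y ->
  #|D x w'| = #|D x w|.+1 -> next c w = w'.
Proof.
move=> sub sub' lev; apply: next_c (near_nth sub) _; last by rewrite -lev; apply: near_nth.
by rewrite -lev c_size ltn_addr ?near_lt.
Qed.

Let far_next w w' : D yb w \subset D x y -> D yb w' \subset D x y ->
  #|D yb w'| = #|D yb w|.+1 -> next c w = w'.
Proof.
move=> sub sub' lev; apply: next_c (far_nth sub) _; last by rewrite -addnS -lev; apply: far_nth.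
by rewrite -addnS -lev c_size ltn_add2l far_lt.
Qed.

(** By consecutiveness a crossing edge sits at [x] or at [y]; the one at [x] is the wrap-around of
    the sequence. *)
Let cross_next w w' : D x w \subset D x y -> label_set w' = label_set w ^^ b ->
  (next c w == w') || (next c w' == w).
Proof.
move=> sub w'w; have [_ cons] := cons_xy.
have w'F : label_set w ^^ b \in vertex_sets by rewrite -w'w label_setF.
have [/label_set_inj wx|/label_set_inj wy] := cons _ (label_setF w) w'F sub.
  have w'xb : w' = xb by apply: label_set_inj; rewrite w'w wx xbE.
  have <- : last x (p ++ yb :: q) = w' by rewrite last_cat w'xb.
  by apply/orP; right; rewrite wx; apply/eqP; apply: next_last.
have w'yb : w' = yb by apply: label_set_inj; rewrite w'w wy ybE.
apply/orP; left; rewrite w'yb wy; apply/eqP.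
have nth_p : nth x c (size p) = y by rewrite nth_cat /= ltnSn -p_last (last_nth x).
have nth_q : nth x c (size p).+1 = yb by rewrite nth_cat /= ltnn subnn.
by apply: next_c (esym nth_p) (esym nth_q); rewrite c_size addSn ltnS addnS ltnS leq_addr.
Qed.

(** There are no chords: an edge within a side joins neighbouring levels, and an edge between the
    sides flips [b]. *)
Let c_edge w w' : w \in c -> w' \in c -> e w w' -> cycle_edge c w w'.
Proof.
move=> wc w'c ww'; rewrite /cycle_edge wc w'c !andTb.
have [i w'i] := edge_flip ww'.
have wi : label_set w = label_set w' ^^ i by rewrite w'i flipK.
move: wc w'c; rewrite !mem_c => /near_or_far[] sub /near_or_far[] sub'.
- case: (boolP (i \in D w x)) => iw.
    have := card_sep_flip iw; rewrite -w'i !(sepC _ (label_set x)) => lev.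
    by rewrite (near_next sub' sub lev) eqxx orbT.
  have /card_sep_flip : i \in D w' x by rewrite w'i in_sep_flip (negPf iw) eqxx.
  by rewrite -wi !(sepC _ (label_set x)) => lev; rewrite (near_next sub sub' lev) eqxx.
- have ib : i = b.
    apply/eqP; have := far_label sub'; rewrite w'i in_sep_flipr (negPf (near_label sub)) /=.
    by rewrite eq_sym.
  by apply: cross_next; rewrite // w'i ib.
- have ib : i = b.
    apply/eqP; have := far_label sub; rewrite wi in_sep_flipr (negPf (near_label sub')) /=.
    by rewrite eq_sym.
  by rewrite orbC; apply: cross_next; rewrite // wi ib.
- case: (boolP (i \in D w yb)) => iw.
    have := card_sep_flip iw; rewrite -w'i !(sepC _ (label_set yb)) => lev.
    by rewrite (far_next sub' sub lev) eqxx orbT.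
  have /card_sep_flip : i \in D w' yb by rewrite w'i in_sep_flip (negPf iw) eqxx.
  by rewrite -wi !(sepC _ (label_set yb)) => lev; rewrite (far_next sub sub' lev) eqxx.
Qed.

Lemma zone_cycle_convex : convex_cycle e c.
Proof.
split=> // u v r uc vc [/andP[ur /eqP lr] /dist_sep sr].
have rc : all (mem c) (u :: r).
  apply/allP=> w wr; have := geodesic_sub ur; rewrite lr => /(_ w sr wr) sub.
  move: uc vc; rewrite /= !mem_c => uc vc; apply: (@sep_sub_mid _ (label_set u)).
    by rewrite sepC.
  by apply: subset_trans sub _; apply: (@sep_sub_mid _ (label_set x)).
split=> //; apply: (sub_in_path _ rc ur) => w w' wc w'c.
exact: c_edge.
Qed.

Lemma zone_cycle_size : size c = (#|D x y|.+1).*2.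
Proof. by rewrite c_size addnn p_size. Qed.

End ZoneCycle.

(** * Conditions (a) and (b) in terms of label sets *)

Lemma convex_6_consecutive b A B : convex_cycles_are_6 e ->
  A \in vertex_sets -> A ^^ b \in vertex_sets ->
  B \in vertex_sets -> B ^^ b \in vertex_sets -> A != B ->
  consecutive vertex_sets b A B -> #|sep A B| = 2.
Proof.
move=> all6 /vertex_setP[x ->] /vertex_setP[xb xbE] /vertex_setP[y ->] /vertex_setP[yb ybE].
move=> xy cons; have [p [xp lp sp]] := geodesic_path x y.
have [q [yq lq sq]] := geodesic_path yb xb.
have {}xy : x != y by apply: contra xy => /eqP->.
have := zone_cycle_size (esym xbE) (esym ybE) sp sq.
rewrite all6; last exact: zone_cycle_convex (esym xbE) (esym ybE) xy cons xp lp sp yq lq sq.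
by move/(congr1 half); rewrite doubleK => -[].
Qed.

Lemma vertex_sets_nosq A i j : (forall c, is_cycle e c -> 6 <= size c) -> i != j ->
  A \in vertex_sets -> A ^^ i \in vertex_sets -> A ^^ j \in vertex_sets ->
  A ^^ i ^^ j \notin vertex_sets.
Proof.
move=> girth ij /vertex_setP[u ->] /vertex_setP[ui uiE] /vertex_setP[uj ujE].
apply/vertex_setP=> -[uij uijE].
suff /girth : is_cycle e [:: u; ui; uij; uj] by [].
apply/and3P; split=> //; last first.
  rewrite /= (flip_edge (esym uiE)) (@flip_edge _ _ j) -?uijE ?uiE //=.
  by rewrite e_sym (@flip_edge _ _ i) -?uijE -?ujE 1?flipC // e_sym (flip_edge (esym ujE)).
apply: (@map_uniq _ _ label_set).
apply: (@map_uniq _ _ (fun B : {set 'I_n} => (i \in B, j \in B))).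
rewrite /= -uiE -uijE -ujE !in_flip !eqxx (negPf ij) eq_sym (negPf ij) !addbF !addbT.
by case: (i \in label_set u); case: (j \in label_set u).
Qed.

Lemma path_in_6cycle y x z w c : is_cycle e c -> size c = 6 ->
  path_in_cycle [:: y; x; z; w] c ->
  exists a a', uniq [:: y; x; z; w; a; a'] /\ cycle e [:: y; x; z; w; a; a'].
Proof.
move=> /and3P[Uc _ cc] sc.
have ext c' : uniq c' -> cycle e c' -> size c' = 6 -> take 4 c' = [:: y; x; z; w] ->
    exists a a', uniq [:: y; x; z; w; a; a'] /\ cycle e [:: y; x; z; w; a; a'].
  case: c' => [|? [|? [|? [|? [|a [|a' [|//]]]]]]] // U' cc' _ E; exists a, a'.
  by case: E U' cc' => -> -> -> ->.
move=> [i [] E]; apply: ext E; rewrite ?rot_uniq ?rev_uniq ?rot_cycle ?size_rot ?size_rev //.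
rewrite rev_cycle; rewrite (eq_cycle (e' := e)) // => ? ?; exact: e_sym.
Qed.

(** Around a hexagon every label is flipped an even number of times. For a hexagon through [A ^^ b],
    [A], [A ^^ i], [A ^^ i ^^ j] this forces the closing edge at [A ^^ b] to flip [j]. *)
Lemma three_paths_flip A b i j : (forall c, is_cycle e c -> 6 <= size c) ->
  three_paths_in_6cycles e -> i != b -> j != i ->
  A \in vertex_sets -> A ^^ b \in vertex_sets -> A ^^ i \in vertex_sets ->
  A ^^ i ^^ j \in vertex_sets -> A ^^ b ^^ j \in vertex_sets.
Proof.
move=> girth paths6 ib ji AF AbF AiF AijF.
have nosq l m := @vertex_sets_nosq A l m girth.
have jb : j != b.
  by apply: contraTneq AijF => ->; apply: nosq.
move: AF AbF AiF AijF nosq.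
move=> /vertex_setP[x ->] /vertex_setP[y yE] /vertex_setP[z zE] /vertex_setP[w wE] nosq.
have [|c [cc [sc pc]]] := paths6 [:: y; x; z; w].
  split=> //; last first.
    exists y, [:: x; z; w]; split=> //=.
    by rewrite e_sym (flip_edge (esym yE)) (flip_edge (esym zE)) (@flip_edge _ _ j) -?wE -?zE.
  apply: (@map_uniq _ _ label_set).
  apply: (@map_uniq _ _ (fun B : {set 'I_n} => (b \in B, i \in B, j \in B))).
  rewrite /= -yE -zE -wE !in_flip !eqxx (eq_sym b) (eq_sym b j) (eq_sym i j).
  rewrite (negPf ib) (negPf jb) (negPf ji) !addbF !addbT.
  by case: (b \in _); case: (i \in _); case: (j \in _).
have [a [a' [U /=]]] := path_in_6cycle cc sc pc.
case/and5P=> _ _ _ /edge_flip[l1 l1E] /and3P[/edge_flip[l2 l2E] /edge_flip[l3 l3E] _].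
have a'E : label_set a' = label_set x ^^ b ^^ l3 by rewrite yE l3E flipK.
have U' k l : k < 6 -> l < 6 ->
    (nth y [:: y; x; z; w; a; a'] k == nth y [:: y; x; z; w; a; a'] l) = (k == l).
  by move=> kl ll; apply: nth_uniq.
have ya : (y == a) = false := U' 0 4 isT isT.
have xa' : (x == a') = false := U' 1 5 isT isT.
have l3b : l3 != b.
  apply/eqP=> l3b; move: a'E; rewrite l3b flipK => /label_set_inj a'x.
  by rewrite a'x eqxx in xa'.
have l3i : l3 != i.
  apply/eqP=> l3i; have biF : label_set x ^^ b ^^ i \in vertex_sets.
    by rewrite -l3i -a'E label_setF.
  by have := nosq b i; rewrite eq_sym ib biF yE zE !label_setF => /(_ isT isT isT isT).
have l23 : l3 != l2.
  apply/eqP=> l23; move: l3E; rewrite l2E l23 flipK => /label_set_inj ay.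
  by rewrite ay eqxx in ya.
suff l3j : l3 = j by rewrite -l3j yE -yE -a'E label_setF.
(* If [l3] is not [j], parity pairs it with [l1]; then [b] and [i] would both be paired with
   [l2]. *)
apply/eqP/negPn/negP=> l3j.
have E t : (t == b) = (t == i) (+) (t == j) (+) (t == l1) (+) (t == l2) (+) (t == l3).
  apply: (@addbI (t \in label_set x)); rewrite !addbA -!in_flip.
  by rewrite wE -l1E -l2E -l3E yE.
have /eqP l31 : l3 == l1.
  have := E l3; rewrite (negPf l3b) (negPf l3i) (negPf l3j) (negPf l23) eqxx /=.
  by case: (l3 == l1).
subst l1; have := E b; have := E i.
rewrite !eqxx (eq_sym b i) (negPf ib) (eq_sym b j) (negPf jb) (eq_sym i j) (negPf ji).
rewrite (eq_sym b l3) (negPf l3b) (eq_sym i l3) (negPf l3i) /= !addbF.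
case: eqP => // il2 _; case: eqP => // bl2 _.
by rewrite il2 bl2 eqxx in ib.
Qed.

(** Four successive vertices of the cycle lie on a hexagon. Their ends are at distance three, so the
    other half of the hexagon is a geodesic too; convexity puts it on the cycle, which then closes
    after six steps. *)
Lemma three_paths_convex_6 : (forall c, is_cycle e c -> 6 <= size c) ->
  three_paths_in_6cycles e -> convex_cycles_are_6 e.
Proof.
move=> girth paths6 c [cc conv]; have size_c := girth c cc.
case: c => [|y [|x [|z [|w [|a0 [|a1 s]]]]]] // in cc conv size_c *.
set c := [:: y, x, z, w, a0, a1 & s] in cc conv size_c *.
have [Uc _ pc] := and3P cc.
have nexti k : k.+1 < size c -> next c (nth y c k) = nth y c k.+1 by apply: next_nth_uniq.
have neqi k l : k < size c -> l < size c -> (nth y c k == nth y c l) = (k == l).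
  by move=> kc lc; apply: nth_uniq.
have [yx /and3P[xz zw _]] := andP pc.
have [|d [dd [sd pd]]] := paths6 [:: y; x; z; w].
  split=> //; last by exists y, [:: x; z; w]; rewrite /= yx xz zw.
  by apply: subseq_uniq Uc; rewrite (prefix_subseq [:: y; x; z; w]).
have [a [a' [U /and5P[_ _ _ wa /and3P[aa' a'y _]]]]] := path_in_6cycle dd sd pd.
have [b xE] := edge_flip yx; have [i zE] := edge_flip xz; have [j wE] := edge_flip zw.
have bi : b != i.
  apply: contraFneq (neqi 0 2 isT isT) => bi; apply/eqP/label_set_inj.
  by rewrite /= zE xE bi flipK.
have ij : i != j.
  apply: contraFneq (neqi 1 3 isT isT) => ij; apply/eqP/label_set_inj.
  by rewrite /= wE zE ij flipK.
have bj : b != j.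
  apply/eqP=> bj; have := vertex_sets_nosq girth bi (label_setF y).
  rewrite -xE -zE !label_setF (_ : _ ^^ i = label_set w) ?label_setF.
    by move=> /(_ isT isT).
  by rewrite wE zE xE bj flipC flipK.
have dyw : #|D y w| = 3.
  have i1 : i \notin D y x by rewrite xE in_sep_flipr sepAA inE eq_sym.
  have j1 : j \notin D y z.
    by rewrite zE xE !in_sep_flipr sepAA inE !(eq_sym j) (negPf bj) (negPf ij).
  by rewrite wE (sep_fliprU j1) cardsU1 j1 zE (sep_fliprU i1) cardsU1 i1 xE sep_flip cards1.
have [|||_ /=] := conv y w [:: a'; a; w].
- by rewrite mem_head.
- by rewrite !inE eqxx !orbT.
- split; first by rewrite /= e_sym a'y e_sym aa' e_sym wa eqxx.
  by have := f_dist y w; rewrite hamming_sep dyw.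
case/and4P=> /and3P[_ _ E1] /and3P[_ _ E2] /and3P[_ _ E3] _.
have U' k l : k < 6 -> l < 6 ->
    (nth y [:: y; x; z; w; a; a'] k == nth y [:: y; x; z; w; a; a'] l) = (k == l).
  by move=> kl ll; apply: nth_uniq.
have na' : next c a' = y.
  case/orP: E1 => /eqP //; rewrite (nexti 0 isT) => xa'.
  by have := U' 1 5 isT isT; rewrite /= (xa' : x = a') eqxx.
have nw : next c w = a.
  case/orP: E3 => /eqP //; rewrite -[RHS](nexti 2 isT) => /(can_inj (prev_next Uc)) az.
  by have := U' 2 4 isT isT; rewrite /= (az : a = z) eqxx.
have na : next c a = a'.
  case/orP: E2 => /eqP //; rewrite na' => ya.
  by have := U' 0 4 isT isT; rewrite /= -ya eqxx.
have aE : a = a0 by rewrite -nw (nexti 3 isT).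
have a'E : a' = a1 by rewrite -na aE (nexti 4 isT).
rewrite /c; case: s @c Uc cc conv size_c pc nexti neqi na' {E1 E2 E3 nw na} => // t s c.
move=> _ _ _ _ _ nexti neqi; rewrite a'E (nexti 5 isT) => ty.
by have := neqi 6 0 isT isT; rewrite ty eqxx.
Qed.

(** * The isomorphism with the Doubled Odd graph *)

(** The map [g] numbers the elements of [M]; a vertex goes to the preimage under [g] of its
    translated label set. *)
Lemma dodd_iso k (M a : {set 'I_n}) : 0 < k -> #|M| = (2 * k).-1 ->
  (forall A, (sep A a \in vertex_sets) = (A \subset M) && mid_size k A) ->
  graph_iso e (@dodd_adj k).
Proof.
move=> k0 cM levels; pose g i := enum_val (cast_ord (esym cM) i).
have g_inj : injective g by move=> i j /enum_val_inj/cast_ord_inj.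
have gM (A : {set 'I_n}) : A \subset M -> g @: (g @^-1: A) = A.
  move=> /subsetP AM; apply/setP=> x; apply/imsetP/idP=> [[i] | xA].
    by rewrite inE => iA ->.
  exists (cast_ord cM (enum_rank_in (AM x xA) x)).
    by rewrite inE /g cast_ordK enum_rankK_in ?AM.
  by rewrite /g cast_ordK enum_rankK_in ?AM.
pose s u := sep (label_set u) a.
have sK u : sep (s u) a = label_set u.
  by apply/setP=> x; rewrite !in_sep -addbA addbb addbF.
have sP u : (s u \subset M) && mid_size k (s u) by rewrite -levels sK label_setF.
have sM u : s u \subset M by case/andP: (sP u).
have smid u : mid_size k (s u) by case/andP: (sP u).
have pre_mid u : mid_size k (g @^-1: s u).
  by rewrite /mid_size -(card_imset _ g_inj) gM //; apply: smid.
pose h u : dodd_vert k := exist _ (g @^-1: s u) (pre_mid u).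
have h_inj : injective h.
  move=> u v /(congr1 (fun A : dodd_vert k => g @: val A)); rewrite /= !gM // => suv.
  by apply: label_set_inj; rewrite -sK suv sK.
have h_surj B : B \in codom h.
  have := levels (g @: val B); rewrite /mid_size (card_imset _ g_inj) (valP B) andbT.
  have -> : g @: val B \subset M.
    by apply/subsetP=> x /imsetP[i _ ->]; apply: enum_valP.
  case/vertex_setP=> u uE; apply/codomP; exists u; apply: val_inj => /=.
  have -> : s u = g @: val B.
    by rewrite /s -uE; apply/setP=> x; rewrite !in_sep -addbA addbb addbF.
  by apply/setP=> i; rewrite inE (mem_imset _ _ g_inj).
exists h; split.
  apply: inj_card_bij => //; rewrite -(card_codom h_inj).
  by apply: subset_leq_card; apply/subsetP=> B _; apply: h_surj.
move=> u v; rewrite edge_sep /dodd_adj /= -!(card_imset (mem (g @^-1: _)) g_inj).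
have sub w w' : (g @^-1: s w \subset g @^-1: s w') = (s w \subset s w').
  apply/idP/idP; last exact: preimsetS.
  by move/(imsetS g); rewrite !gM.
rewrite !gM // !sub -(mid_adj k0) //; congr (#|pred_of_set _| == 1).
by apply/setP=> x; rewrite !in_sep; do 3!case: (_ \in _).
Qed.

End Embedding.

Theorem theorem4p2 (T : finType) (e : rel T) (k : nat) :
  symmetric e -> irreflexive e ->
  partial_cube e -> regular e k -> girth_is e 6 ->
  (convex_cycles_are_6 e <-> three_paths_in_6cycles e) /\
  (three_paths_in_6cycles e <-> graph_iso e (@dodd_adj k)).
Proof.
move=> e_sym e_irr [n [f f_dist]] reg [[c0 [cyc0 sc0]] girth].
have [x [y xy]] : exists x y, e x y.
  case: c0 cyc0 sc0 => [|x [|y c]] // /and3P[_ _ /andP[xy _]] _.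
  by exists x, y.
have k0 : 0 < k by rewrite -(reg x); apply/card_gt0P; exists y; rewrite inE.
pose F := vertex_sets f.
have isoF := vertex_sets_iso e_irr f_dist.
have nosq A i j : i != j -> A \in F -> A ^^ i \in F -> A ^^ j \in F ->
    A ^^ i ^^ j \notin F.
  exact: (vertex_sets_nosq e_sym e_irr f_dist girth).
have regF A : A \in F -> #|nbrs F A| = k.
  by move=> /vertex_setP[u ->]; rewrite (card_nbrs e_irr f_dist) reg.
have xF : label_set f x \in F by apply: label_setF.
have [b yE] := edge_flip e_irr f_dist xy.
have xbF : label_set f x ^^ b \in F by rewrite -yE; apply: label_setF.
(* Both (a) and (b) reach (c) through a single edge with the local condition: under (b) any edge has
   it, under (a) an edge at a minimal halfspace. *)
have edge_iso A i : A \in F -> A ^^ i \in F ->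
    (forall j l, j != i -> l != j -> A ^^ j \in F -> A ^^ j ^^ l \in F ->
       A ^^ i ^^ l \in F) ->
    graph_iso e (@dodd_adj k).
  move=> AF AiF closed; have sp := spoke_edge nosq regF AF AiF closed.
  have iA : i \in nbrs F A by rewrite in_nbrs.
  have [M [a [cM levels]]] := middle_levels isoF nosq regF sp iA.
  exact: (dodd_iso e_irr f_dist k0 cM levels).
have ba : three_paths_in_6cycles e -> convex_cycles_are_6 e.
  exact: (three_paths_convex_6 e_sym e_irr f_dist girth).
have cb := dodd_three_paths k0.
have bc : three_paths_in_6cycles e -> graph_iso e (@dodd_adj k).
  move=> paths6; apply: (edge_iso _ b xF xbF) => i j ib ji iF ijF.
  exact: (three_paths_flip e_sym e_irr f_dist girth paths6 ib ji).
have ac : convex_cycles_are_6 e -> graph_iso e (@dodd_adj k).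
  move=> all6.
  have zone2 i A B :=
    convex_6_consecutive e_sym e_irr f_dist (b := i) (A := A) (B := B) all6.
  have [A [i [AF AiF closed]]] := minimal_halfspace_edge isoF nosq zone2 xF xbF.
  exact: edge_iso closed.
by split; split; [move=> /ac /cb | exact: ba | exact: bc | exact: cb].
Qed.
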